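(* Let $r\geq 1$ be an integer. For all integers $n\geq 2$, $$ p_{-r}(n)=r\,\theta(n)+\sum_{k=1}^{n-1}\frac{r^{k+1}}{(k+1)!} \sum_{\alpha_1=k}^{n-1}\ \sum_{\alpha_2=k-1}^{\alpha_1-1} \cdots \sum_{\alpha_k=1}^{\alpha_{k-1}-1}\theta(n-\alpha_1)\, \theta(\alpha_1-\alpha_2) \cdots \theta(\alpha_{k-1}-\alpha_k)\, \theta(\alpha_k), $$ where $\theta(m)=\sigma(m)/m$ for every positive integer $m$.
   Context: For a positive integer $m$, $\sigma(m)=\sum_{d\mid m}d$ is the sum of the positive divisors of $m$. For a positive integer $r$, $p_{-r}(n)$ is the number of $r$-coloured partitions of $n$, i.e. partitions of $n$ in which each part can occur in $r$ colours. Equivalently, $\sum_{n=0}^{\infty}p_{-r}(n)q^{n}=E(q)^{-r}$, where $E(q)=\prod_{j=1}^{\infty}(1-q^{j})$ and $|q|<1$. In the inner $k$-fold sum, the index $\alpha_i$ ranges from $k-i+1$ to $\alpha_{i-1}-1$ for $1\le i\le k$, with $\alpha_0=n$. For $k=1$ the inner sum is $\sum_{\alpha_1=1}^{n-1}\theta(n-\alpha_1)\theta(\alpha_1)$. *)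

(* Defs.v *)
From mathcomp Require Import all_boot all_order all_algebra.

Set Implicit Arguments.
Unset Strict Implicit.
Unset Printing Implicit Defensive.

Import Order.TTheory GRing.Theory Num.Theory.

Definition sigma (m : nat) : nat := \sum_(d <- divisors m) d.

Definition theta (m : nat) : rat := ((sigma m)%:R / m%:R)%R.

(* An r-coloured partition of n is a finite multiset of coloured parts of total
   size n, given here by its multiplicities: f (j, c) is the number of parts of
   size j.+1 and colour c.  In such a multiset both the parts and the
   multiplicities are at most n, so the bounds in the type lose nothing.  The
   number of these partitions is p_{-r}(n), the coefficient of q^n in
   \prod_(j >= 1) (1 - q^j)^(-r). *)
Definition is_coloured_partition (r n : nat)
    (f : {ffun 'I_n * 'I_r -> 'I_n.+1}) : bool :=
  \sum_(x : 'I_n * 'I_r) x.1.+1 * f x == n.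

Definition num_coloured_partitions (r n : nat) : nat :=
  #|[set f : {ffun 'I_n * 'I_r -> 'I_n.+1} | is_coloured_partition f]|.

Local Open Scope ring_scope.

(* \sum_(a_1 = k)^(a_0 - 1) \sum_(a_2 = k - 1)^(a_1 - 1) ...
     \sum_(a_k = 1)^(a_(k-1) - 1) F [:: a_1; ...; a_k].
   The lower bound of each sum, k - i + 1 for a_i, is the number of sums still
   to be taken, that sum included. *)
Fixpoint nested_sum (k a0 : nat) (F : seq nat -> rat) : rat :=
  if k is k'.+1 then
    \sum_(k'.+1 <= a < a0) nested_sum k' a (fun s => F (a :: s))
  else F [::].

(* theta(a_0 - a_1) theta(a_1 - a_2) ... theta(a_(k-1) - a_k) theta(a_k), where
   a_0 = n and s = [:: a_1; ...; a_k]; inside nested_sum k n the a_i are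
   strictly decreasing, so no subtraction is truncated. *)
Definition theta_chain (n : nat) (s : seq nat) : rat :=
  (\prod_(i < size s) theta (nth 0%N (n :: s) i - nth 0%N (n :: s) i.+1)%N)
  * theta (last n s).

(* Main.v *)
Require Import Defs.
From mathcomp Require Import all_boot all_order all_algebra.
From mathcomp Require Import ring.

(** Taking logarithms in E(q)^(-r) = \prod_(j >= 1) (1 - q^j)^(-r) and expanding
    each log (1 - q^j) gives r \sum_m theta(m) q^m =: r Theta(q), so that
    E(q)^(-r) = exp (r Theta(q)) = \sum_k r^k / k! Theta(q)^k.  The nested sum
    over a_1 > ... > a_k is the coefficient of q^n in Theta(q)^(k+1), since the
    arguments n - a_1, a_1 - a_2, ..., a_k of theta run over the compositions of
    n into k + 1 positive parts; comparing coefficients of q^n gives the formula.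

    Only coefficients up to q^n matter, so everything is done with polynomials
    modulo X^(n+1), and the logarithm is replaced by the logarithmic derivative.
    The product of truncated geometric series that generates the coloured
    partitions ([coef_colour_gf]) and the truncated exponential of r Theta both
    satisfy the differential equation X F' = S F modulo X^(n+1), where
    S = r \sum_m m theta(m) X^m = r \sum_m sigma(m) X^m
    ([log_deriv_colour_gf], [log_deriv_exp_theta]).  In characteristic 0, as
    S(0) = 0, this equation and the constant term determine F
    ([log_deriv_mod_uniq]).  The coefficients of the powers of Theta are
    identified with the nested sums in [nested_sum_theta]. *)

Import GRing.Theory Num.Theory.
Set Implicit Arguments.
Unset Strict Implicit.
Unset Printing Implicit Defensive.

Local Open Scope ring_scope.

(** * Logarithmic derivatives modulo a power of the variable *)

(** The equation X F' / F = S, cleared of its denominator. *)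
Definition log_deriv_mod (K : fieldType) (N : nat) (S F : {poly K}) : bool :=
  'X^N %| 'X * F^`() - S * F.

Lemma dvdXnP (K : fieldType) (N : nat) (p : {poly K}) :
  reflect (forall i, (i < N)%N -> p`_i = 0) ('X^N %| p).
Proof.
apply: (iffP idP) => [/dvdpP[q ->] i ltiN|p0]; first by rewrite coefMXn ltiN.
rewrite -(poly_take_drop N p) dvdp_addl ?dvdp_mulIr //.
have -> : take_poly N p = 0; last exact: dvdp0.
by apply/polyP=> i; rewrite coef_take_poly coef0; case: ifP => // /p0.
Qed.

Lemma coefXderiv (K : fieldType) (p : {poly K}) (i : nat) :
  ('X * p^`())`_i = i%:R * p`_i.
Proof.
by rewrite coefXM coef_deriv mulr_natl; case: i => [|i]; rewrite ?mulr0n.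
Qed.

(** The difference H of two solutions is a solution with H_0 = 0.  Comparing
    coefficients, i H_i = \sum_(j <= i) S_j H_(i - j); the term j = 0 vanishes
    with S_0, and the others by induction, so H_i = 0 as i is invertible. *)
Lemma log_deriv_mod_uniq (K : numFieldType) (N : nat) (S F G : {poly K}) :
    log_deriv_mod N S F -> log_deriv_mod N S G ->
    S`_0 = 0 -> F`_0 = G`_0 ->
  forall i, (i < N)%N -> F`_i = G`_i.
Proof.
move=> dF dG S0 FG0.
have /dvdXnP dH : log_deriv_mod N S (F - G).
  rewrite /log_deriv_mod derivB.
  have -> : 'X * (F^`() - G^`()) - S * (F - G)
    = ('X * F^`() - S * F) - ('X * G^`() - S * G) by ring.
  by rewrite dvdp_sub.
suff H0 i : (i < N)%N -> (F - G)`_i = 0.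
  by move=> i /H0; rewrite coefB => /subr0_eq.
elim/ltn_ind: i => i IH ltiN.
case: (posnP i) => [->|i_gt0]; first by rewrite coefB FG0 subrr.
have := dH i ltiN; rewrite coefB coefXderiv coefM big1 => [/eqP|].
  by rewrite subr0 mulf_eq0 pnatr_eq0 -leqn0 leqNgt i_gt0 => /eqP.
case=> [[|j]] /= ltji _; first by rewrite S0 mul0r.
have lt_ij : (i - j.+1 < i)%N by rewrite ltn_subrL.
by rewrite (IH _ lt_ij) ?mulr0 // (ltn_trans lt_ij).
Qed.

Lemma log_deriv_mod_prod (K : fieldType) (N : nat) (I : Type) (s : seq I)
    (S F : I -> {poly K}) :
    (forall x, log_deriv_mod N (S x) (F x)) ->
  log_deriv_mod N (\sum_(x <- s) S x) (\prod_(x <- s) F x).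
Proof.
move=> dF; rewrite /log_deriv_mod; elim: s => [|x s IH].
  by rewrite !big_nil -polyC1 derivC mulr0 mul0r subr0 dvdp0.
rewrite !big_cons derivM; move: IH (dF x); rewrite /log_deriv_mod.
set T := \sum_(y <- s) _; set Q := \prod_(y <- s) _ => dQ dFx.
have -> : 'X * ((F x)^`() * Q + F x * Q^`()) - (S x + T) * (F x * Q)
  = Q * ('X * (F x)^`() - S x * F x) + F x * ('X * Q^`() - T * Q) by ring.
by rewrite dvdp_add // dvdp_mull.
Qed.

Lemma log_deriv_mod_congr (K : fieldType) (N : nat) (S T F : {poly K}) :
    (forall i, (i < N)%N -> S`_i = T`_i) ->
  log_deriv_mod N S F -> log_deriv_mod N T F.
Proof.
move=> ST; rewrite /log_deriv_mod => dF.
have -> : 'X * F^`() - T * F = ('X * F^`() - S * F) + (S - T) * F by ring.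
rewrite dvdp_add // dvdp_mulr //; apply/dvdXnP=> i /ST.
by rewrite coefB => ->; rewrite subrr.
Qed.

(** * The truncated geometric series *)

Definition trunc_geom (K : fieldType) (n d : nat) : {poly K} :=
  \sum_(i < n.+1) 'X^(d * i).

(** With Y = X^d, the series P = 1 / (1 - Y) has X P' / P = d Y / (1 - Y)
    = d Y P.  For the truncation, P (1 - Y) = 1 - Z with Z = X^(d (n+1)), and
    differentiating this relation shows that the error is a multiple of Z. *)
Lemma log_deriv_trunc_geom (K : fieldType) (n d : nat) : (0 < d)%N ->
  log_deriv_mod n.+1 (d%:R * 'X^d * trunc_geom K n d) (trunc_geom K n d).
Proof.
move=> d_gt0; rewrite /log_deriv_mod; set P := trunc_geom K n d.
pose Y : {poly K} := 'X^d; pose Z : {poly K} := 'X^(d * n.+1).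
have PE : P * (1 - Y) = 1 - Z.
  have -> : P = \sum_(i < n.+1) Y ^+ i.
    by apply: eq_bigr => i _; rewrite exprM.
  have := subrX1 Y n.+1; rewrite -exprM -/Z => E.
  by rewrite -[RHS]opprB E; ring.
have dX k : (0 < k)%N -> 'X * ('X^k)^`() = k%:R * 'X^k :> {poly K}.
  by case: k => // k _; rewrite derivXn mulrnAr -exprS mulr_natl.
have := congr1 (fun p => 'X * p^`()) PE.
rewrite derivM !derivB -polyC1 derivC polyC1 => E.
have -> : 'X * P^`() - d%:R * 'X^d * P * P =
   Z * ('X * P^`() - (d * n.+1)%:R * P).
  rewrite -/Y; set A := 'X * P^`() in E *.
  have {}E : A * (1 - Y) = d%:R * Y * P - (d * n.+1)%:R * Z.
    transitivity ('X * (P^`() * (1 - Y) + P * (0 - Y^`())) + 'X * Y^`() * P).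
      by rewrite /A; ring.
    by rewrite E dX // mulrBr mulr0 sub0r dX ?muln_gt0 ?d_gt0 // addrC.
  apply/eqP; rewrite -subr_eq0; apply/eqP.
  (* Multiply E by P and use P (1 - Y) = 1 - Z. *)
  transitivity (A * (1 - Z) - P * (d%:R * Y * P - (d * n.+1)%:R * Z)).
    by ring.
  by rewrite -E -PE; ring.
by rewrite dvdp_mulr // dvdp_exp2l // leq_pmull.
Qed.

(** This is d Y + d Y^2 + ... up to degree n: the contribution of the divisor d
    to sigma(m), for every positive m at once. *)
Lemma coef_log_deriv_trunc_geom (K : fieldType) (n d m : nat) :
    (0 < d)%N -> (m <= n)%N ->
  (d%:R * 'X^d * trunc_geom K n d)`_m =
    (if (0 < m)%N && (d %| m)%N then d else 0)%:R.
Proof.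
move=> d_gt0 le_mn.
rewrite -mulrA mulr_natl coefMn coefXnM.
case: ltnP => [ltmd | ledm].
  rewrite mul0rn; case: (posnP m) => //= m_gt0.
  by case: ifP => // /(dvdn_leq m_gt0); rewrite leqNgt ltmd.
rewrite (leq_trans d_gt0 ledm) /= /trunc_geom coef_sum.
have -> : \sum_(i < n.+1) ('X^(d * i)%N : {poly K})`_(m - d)%N
          = (d %| m)%N%:R; last by case: (d %| m)%N; rewrite ?mul0rn.
case: (boolP (d %| m)%N) => [/dvdnP[q def_m] | ndvd].
  (* Y P starts at Y^1, so Y^q comes from the term of index q - 1 of P. *)
  have lt_qn : (q.-1 < n.+1)%N.
    by rewrite ltnS (leq_trans (leq_pred q)) // (leq_trans _ le_mn) // def_m
               leq_pmulr.
  have q_gt0 : (0 < q)%N.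
    by case: q def_m ledm {lt_qn} => // ->; rewrite leqNgt d_gt0.
  have def_md : (m - d = d * q.-1)%N.
    by rewrite def_m -{2}[d]mul1n -mulnBl subn1 mulnC.
  rewrite (bigD1 (Ordinal lt_qn)) //= coefXn def_md eqxx big1 ?addr0 // => i ne_i.
  rewrite coefXn eqn_pmul2l // eq_sym.
  by case: eqP => // Ei; case/eqP: ne_i; apply: val_inj.
rewrite big1 // => i _; rewrite coefXn; case: eqP => // Emd.
by case/negP: ndvd; rewrite -(subnK ledm) Emd dvdn_add // dvdn_mulr.
Qed.

(** For m > 0 the left-hand side is sigma(m), written here as a sum over all
    part sizes up to n so as to match the logarithmic derivative of the product
    over parts.  At m = 0 both sides are 0, whereas sigma(0) = 1 because
    [divisors 0] is [:: 1]; hence the use of m theta(m) instead of sigma(m). *)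
Lemma natr_mul_theta (n m : nat) : (m <= n)%N ->
  m%:R * theta m =
    (\sum_(j < n) if (0 < m) && (j.+1 %| m) then j.+1 else 0)%N%:R.
Proof.
case: m => [_|m le_mn]; first by rewrite mul0r big1.
rewrite /theta mulrC divfK ?pnatr_eq0 //; congr _%:R.
rewrite -big_mkcond /= /sigma.
rewrite -(big_mkord (fun j => j.+1 %| m.+1)%N (fun j => j.+1)).
rewrite -(big_add1 _ _ 0 n.+1 (fun j => j %| m.+1)%N (fun j => j)).
rewrite -[RHS]big_filter.
apply: perm_big.
apply: uniq_perm; rewrite ?divisors_uniq ?filter_uniq ?iota_uniq //.
move=> d; rewrite -dvdn_divisors // mem_filter mem_index_iota.
case: (boolP (d %| m.+1)%N) => // dvd_d; rewrite (dvdn_gt0 _ dvd_d) //= ltnS.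
by rewrite (leq_trans (dvdn_leq _ dvd_d)).
Qed.

(** * The generating polynomial of coloured partitions *)

(** E(q)^(-r) cut down to the parts of size at most n, each used at most n times
    in each colour; this leaves the coefficients up to q^n unchanged. *)
Definition colour_gf (r n : nat) : {poly rat} :=
  \prod_(x : 'I_n * 'I_r) trunc_geom _ n x.1.+1.

(** Expanding the product amounts to choosing a multiplicity for every coloured
    part, and the exponent of the resulting monomial is the total size. *)
Lemma coef_colour_gf (r n : nat) :
  (colour_gf r n)`_n = (num_coloured_partitions r n)%:R.
Proof.
rewrite /colour_gf /trunc_geom.
rewrite (bigA_distr_bigA
  (fun (x : 'I_n * 'I_r) (i : 'I_n.+1) => 'X^(x.1.+1 * i))).
rewrite coef_sum /num_coloured_partitions -sum1_card natr_sum [RHS]big_mkcond /=.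
apply: eq_bigr => f _; rewrite inE /is_coloured_partition.
rewrite -(big_morph (fun m => 'X^m : {poly rat})
  (fun m k => exprD 'X m k) (expr0 'X)).
by rewrite coefXn eq_sym; case: ifP.
Qed.

Lemma log_deriv_colour_gf (r n : nat) :
  log_deriv_mod n.+1 (\poly_(i < n.+1) (r%:R * (i%:R * theta i)))
    (colour_gf r n).
Proof.
apply: log_deriv_mod_congr; last first.
  by apply: log_deriv_mod_prod => x; apply: log_deriv_trunc_geom.
move=> m; rewrite ltnS => le_mn; rewrite coef_poly ltnS le_mn coef_sum.
under eq_bigr do rewrite coef_log_deriv_trunc_geom //.
rewrite -(pair_bigA _ (fun (j : 'I_n) (c : 'I_r) =>
   (if (0 < m) && (j.+1 %| m) then j.+1 else 0)%N%:R)) exchange_big /=.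
by rewrite sumr_const card_ord -natr_sum (natr_mul_theta le_mn) mulr_natl.
Qed.

(** * The exponential of the theta series *)

Definition theta_poly (n : nat) : {poly rat} := \poly_(i < n.+1) theta i.

(** Division by 0 gives 0, so theta 0 is the right constant term. *)
Lemma theta0 : theta 0 = 0.
Proof. by rewrite /theta invr0 mulr0. Qed.

Lemma dvdX_theta_poly (n k : nat) : 'X^k %| theta_poly n ^+ k.
Proof.
apply: dvdp_exp2r; apply/(@dvdXnP _ 1) => -[|//] _.
by rewrite coef_poly /= theta0.
Qed.

Definition exp_theta (r n : nat) : {poly rat} :=
  \sum_(k < n.+1) (r%:R ^+ k / k`!%:R) *: theta_poly n ^+ k.

(** Differentiating the exponential series term by term shifts it by one, which
    gives X E' = r X T' (E - c T^n), where T is the theta polynomial and c T^n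
    the last term of E.  The error r X T' c T^n is divisible by X T^n, hence by
    X^(n+1) because T has no constant term. *)
Lemma log_deriv_exp_theta (r n : nat) :
  log_deriv_mod n.+1 (\poly_(i < n.+1) (r%:R * (i%:R * theta i)))
    (exp_theta r n).
Proof.
set T := theta_poly n.
apply: (@log_deriv_mod_congr _ _ (r%:R *: ('X * T^`()))) => [i lt_in|].
  by rewrite coefZ coefXderiv !coef_poly lt_in.
rewrite /log_deriv_mod /exp_theta -/T raddf_sum big_ord_recl /=.
rewrite !expr0 derivZ -polyC1 derivC scaler0 add0r.
under eq_bigr => i _.
  have -> : ((r%:R ^+ lift ord0 i / (lift ord0 i)`!%:R) *: T ^+ lift ord0 i)^`()
     = r%:R *: (T^`() * ((r%:R ^+ i / i`!%:R) *: T ^+ i)).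
    rewrite derivZ lift0 deriv_exp -scaler_nat -!scalerAr !scalerA /=.
    congr (_ *: _).
    rewrite factS natrM exprS.
    by field; rewrite nat1r !pnatr_eq0 -lt0n fact_gt0.
  over.
rewrite -scaler_sumr -mulr_sumr big_ord_recr /=.
set S := \sum_(i < n) _.
set c := _ / _.
have -> : 'X * (r%:R *: (T^`() * S)) - r%:R *: ('X * T^`()) * (S + c *: T ^+ n)
  = 'X * T ^+ n * (- (c *: (r%:R *: T^`()))).
  rewrite -!mul_polyC; ring.
by rewrite dvdp_mulr // exprS dvdp_mul ?dvdX_theta_poly.
Qed.

(** * Nested sums as coefficients of powers *)

Lemma nested_sum_scale (k a : nat) (c : rat) (F G : seq nat -> rat) :
  (forall s, F s = c * G s) -> nested_sum k a F = c * nested_sum k a G.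
Proof.
move=> FG; elim: k a F G FG => [|k IH] a F G FG /=; first exact: FG.
by rewrite mulr_sumr; apply: eq_bigr => b _; apply: IH => s; apply: FG.
Qed.

Lemma theta_chain_cons (a b : nat) (s : seq nat) :
  theta_chain a (b :: s) = theta (a - b) * theta_chain b s.
Proof. by rewrite /theta_chain /= big_ord_recl mulrA. Qed.

(** Splitting off the outermost sum is the convolution with one more factor
    Theta.  The convolution runs over all b <= a, but b = a contributes
    theta(0) = 0, and each b <= k contributes 0 because Theta^(k+1) has no term
    of degree below k + 1; this leaves the range of the nested sum. *)
Lemma nested_sum_theta (n k a : nat) : (a <= n)%N ->
  nested_sum k a (theta_chain a) = (theta_poly n ^+ k.+1)`_a.
Proof.
elim: k a => [|k IH] a le_an.
  by rewrite /= /theta_chain big_ord0 mul1r /= expr1 coef_poly ltnS le_an.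
rewrite exprS coefMr big_ord_recr /= subnn {2}/theta_poly coef_poly theta0 mul0r.
rewrite addr0 big_geq_mkord big_mkcond; apply: eq_bigr => b _ /=.
have le_bn : (b <= n)%N by rewrite ltnW // (leq_trans (ltn_ord b)).
rewrite (nested_sum_scale _ _ (theta_chain_cons a b)) IH // coef_poly.
rewrite ltnS (leq_trans (leq_subr _ _) le_an); case: ltnP => // lt_bk.
by rewrite (dvdXnP _ _ (dvdX_theta_poly n k.+1)) ?mulr0.
Qed.

Theorem theorem1 (r : nat) (hr : (1 <= r)%N) (n : nat) (hn : (2 <= n)%N) :
  (num_coloured_partitions r n)%:R =
    r%:R * theta n
    + \sum_(1 <= k < n)
        r%:R ^+ k.+1 / (k.+1)`!%:R * nested_sum k n (theta_chain n).
Proof.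
rewrite -coef_colour_gf.
have -> : (colour_gf r n)`_n = (exp_theta r n)`_n.
  apply: (log_deriv_mod_uniq (log_deriv_colour_gf r n)
                             (log_deriv_exp_theta r n)) (ltnSn n).
    by rewrite coef_poly mul0r mulr0.
  (* Constant terms are values at 0; both are 1. *)
  rewrite -!horner_coef0 /colour_gf /exp_theta horner_prod horner_sum.
  rewrite big1 => [|x _].
    rewrite big_ord_recl big1 /= => [|i _].
      by rewrite !expr0 fact0 divr1 scale1r -polyC1 hornerC addr0.
    by rewrite hornerZ horner_exp horner_coef0 coef_poly theta0 expr0n mulr0.
  rewrite /trunc_geom horner_sum big_ord_recl big1 => [|i _].
    by rewrite muln0 expr0 hornerC addr0.
  by rewrite hornerXn lift0 expr0n muln_eq0.
rewrite /exp_theta coef_sum -(big_mkord xpredT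
   (fun k => ((r%:R ^+ k / k`!%:R) *: theta_poly n ^+ k)`_n)).
(* The term k = 0 is a constant and n > 0; the term k = 1 is r theta(n). *)
rewrite big_ltn // coefZ expr0 coef1 gtn_eqF ?(ltnW hn) // mulr0 add0r.
rewrite big_add1 /= big_ltn ?(ltnW hn) //; congr (_ + _).
  by rewrite coefZ expr1 divr1 coef_poly ltnSn.
by apply: eq_bigr => k _; rewrite coefZ (nested_sum_theta _ (leqnn n)).
Qed.
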